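(* Let $G:\mathbb{R}^n\to\mathbb{R}$ be a continuous conditionally negative definite function with $G(0)=0$, and let $T\subseteq\Pi_n$ be a lower set. If for every $\pi\in T\setminus\{\hat{\mathbf{1}}_n\}$ $$\lim_{\min_{1\leq i\leq n}|x_i|\to\infty}\big(G(x)-G_\pi(x)\big)=-\infty,$$ then the function $T[e^{-G}]$ is not identically zero on $\mathbb{R}^n$.
   Context: $\Pi_n$ denotes the set of all partitions of $\{1,\dots,n\}$ into nonempty disjoint blocks, ordered by refinement: $\pi\le\sigma$ iff every block of $\pi$ is contained in a block of $\sigma$; $|\pi|$ is the number of blocks; $\hat{\mathbf{0}}_n$ is the partition into singletons and $\hat{\mathbf{1}}_n$ the one-block partition. A lower set of $\Pi_n$ is a subset $T$ containing $\hat{\mathbf 0}_n$ and $\hat{\mathbf 1}_n$ such that $w\in T\setminus\{\hat{\mathbf 1}_n\}$, $z\in\Pi_n$, $z\le w$ imply $z\in T$. With the induced order, $\mu$ is the M\''obius function of the poset $T$: $\mu(x,x)=1$, $\mu(x,y)=-\sum_{z\in T,\,x\le z<y}\mu(x,z)$ for $x<y$ in $T$, $0$ otherwise. For $x\in\mathbb{R}^n$ and $F\subseteq\{1,\dots,n\}$, $(x_F,\vec{0})\in\mathbb{R}^n$ agrees with $x$ on $F$ and is zero off $F$. For $\pi=(F_1,\dots,F_{|\pi|})$: $G_\pi(x):=\sum_{i=1}^{|\pi|}G(x_{F_i},\vec{0})$, and for a function $f:\mathbb{R}^n\to\mathbb{C}$, $f_\pi(x):=\prod_{i=1}^{|\pi|}f(x_{F_i},\vec{0})$.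 For a continuous positive definite $f$ with $f(0)=1$, $T[f](t):=\sum_{\pi\in T}\mu(\pi,\hat{\mathbf{1}}_n)f_\pi(t)$; this applies to $f=e^{-G}$, which is continuous positive definite with $f(0)=1$ when $G$ is as in the claim. A function $G:\mathbb{R}^n\to\mathbb{C}$ is conditionally negative definite if $G(-x)=\overline{G(x)}$ and, for all finite collections of distinct points $x_1,\dots,x_m\in\mathbb{R}^n$ and scalars $c_1,\dots,c_m\in\mathbb{C}$ with $\sum_ic_i=0$, $\sum_{i,j=1}^mc_i\overline{c_j}G(x_i-x_j)\leq0$. *)

(* Defs.v *)
From HB Require Import structures.
From mathcomp Require Import all_boot all_order all_algebra.
From mathcomp Require Import all_classical all_reals all_analysis.
From mathcomp Require Export complex.

Set Implicit Arguments.
Unset Strict Implicit.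
Unset Printing Implicit Defensive.

Import Order.TTheory GRing.Theory Num.Theory.
Import numFieldNormedType.Exports.

Local Open Scope ring_scope.
Local Open Scope complex_scope.

(* The values at pairs outside T are irrelevant. The first argument of
   mobius_rec bounds the recursion depth; #|T| is enough, see mobiusE. *)
Section Mobius.
Context {d : Order.disp_t} {P : finPOrderType d}.
Implicit Types (T : {set P}) (x y z : P).

Fixpoint mobius_rec (k : nat) T x y : int :=
  if k is k'.+1 then
    if x == y then 1
    else if (x < y)%O then
      - \sum_(z in T | (x <= z)%O && (z < y)%O) mobius_rec k' T x z
    else 0
  else 0.

Definition mobius T x y : int := mobius_rec #|T| T x y.

Lemma mobius_rec_stable k1 k2 T x y : y \in T ->
  (#|[set z in T | (z <= y)%O]| <= k1)%N ->
  (#|[set z in T | (z <= y)%O]| <= k2)%N ->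
  mobius_rec k1 T x y = mobius_rec k2 T x y.
Proof.
elim: k1 k2 y => [|k1 IH] [|k2] y yT.
- by [].
- by rewrite leqn0 cards_eq0 => /eqP/setP/(_ y); rewrite !inE yT lexx.
- by move=> _; rewrite leqn0 cards_eq0 => /eqP/setP/(_ y); rewrite !inE yT lexx.
move=> h1 h2 /=; case: eqP => // _; case: ifP => // xy; congr (- _).
apply: eq_bigr => z /and3P[zT _ zy].
have zyS : ([set w in T | (w <= z)%O] \proper [set w in T | (w <= y)%O])%SET.
  apply/properP; split.
    apply/fintype.subsetP => w; rewrite !inE => /andP[-> wz] /=.
    exact: le_trans wz (ltW zy).
  by exists y; rewrite !inE yT ?lexx // lt_geF.
apply: IH => //; rewrite -ltnS.
  exact: leq_trans (proper_card zyS) h1.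
exact: leq_trans (proper_card zyS) h2.
Qed.

Lemma mobiusE T x y : y \in T ->
  mobius T x y =
    if x == y then 1
    else if (x < y)%O then
      - \sum_(z in T | (x <= z)%O && (z < y)%O) mobius T x z
    else 0.
Proof.
move=> yT.
have leT z : (#|[set w in T | (w <= z)%O]| <= #|T|)%N.
  by apply: subset_leq_card; apply/fintype.subsetP => w; rewrite inE => /andP[].
rewrite {1}/mobius (mobius_rec_stable (k2 := #|T|.+1)) ?leT //.
exact: leqW.
Qed.

End Mobius.

Definition setpart (n : nat) : Type :=
  {P : {set {set 'I_n}} | finset.partition P [set: 'I_n]%SET}.

HB.instance Definition _ n := Finite.on (setpart n).
HB.instance Definition _ n := [isSub of setpart n for @sval _ _].

Section SetPart.
Variable n : nat.
Implicit Types pi sigma : setpart n.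

Definition finer pi sigma : bool :=
  [forall A in val pi, exists B in val sigma, A \subset B].

Lemma finerP pi sigma :
  reflect (forall A, A \in val pi -> exists2 B, B \in val sigma & A \subset B)
          (finer pi sigma).
Proof.
apply: (iffP forallP) => [h A Api|h A].
  by have /implyP/(_ Api)/existsP[B /andP[]] := h A; exists B.
by apply/implyP => /h[B Bs AB]; apply/existsP; exists B; rewrite Bs.
Qed.

Lemma finer_refl : reflexive finer.
Proof. by move=> pi; apply/finerP => A Api; exists A. Qed.

Lemma finer_trans : transitive finer.
Proof.
move=> rho pi sigma /finerP h1 /finerP h2; apply/finerP => A /h1[B /h2[C Cs BC] AB].
by exists C => //; apply: fintype.subset_trans BC.
Qed.

Lemma finer_sub pi sigma : finer pi sigma -> finer sigma pi ->
  (val pi \subset val sigma)%SET.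
Proof.
move=> /finerP h1 /finerP h2; apply/fintype.subsetP => A Api.
have [B Bs AB] := h1 A Api; have [C Cpi BC] := h2 B Bs.
have /and3P[_ /finset.trivIsetP tI n0] := valP pi.
suff AC : A = C.
  suff -> : A = B by [].
  by apply/eqP; rewrite finset.eqEsubset AB /= AC.
have /set0Pn[a aA] : A != finset.set0 by apply: contraNneq n0 => <-.
apply/eqP/negP => /negP AC.
have := tI A C Api Cpi AC.
move/disjointFr => /(_ a aA); rewrite (fintype.subsetP BC) //.
exact: (fintype.subsetP AB).
Qed.

Lemma finer_anti : antisymmetric finer.
Proof.
move=> pi sigma /andP[h1 h2]; apply: val_inj; apply/eqP.
by rewrite finset.eqEsubset !finer_sub.
Qed.

End SetPart.

Fact setpart_display : Order.disp_t. Proof. exact: Order.Disp tt tt. Qed.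

HB.instance Definition _ n :=
  Order.Le_isPOrder.Build setpart_display (setpart n)
    (@finer_refl n) (@finer_anti n) (@finer_trans n).

Lemma singleton_blocks_subproof n :
  finset.partition [set [set i]%SET | i : 'I_n]%SET [set: 'I_n]%SET.
Proof.
apply/and3P; split.
- rewrite finset.eqEsubset finset.subsetT /=; apply/fintype.subsetP => i _.
  apply/bigcupP; exists [set i]%SET; last by rewrite inE.
  by apply/imsetP; exists i.
- apply/finset.trivIsetP => _ _ /imsetP[i _ ->] /imsetP[j _ ->] ij.
  rewrite disjoints1 inE; apply: contraNN ij => /eqP ->; exact: eqxx.
- by apply/imsetP => -[i _] /setP/(_ i); rewrite !inE eqxx.
Qed.

Definition singleton_blocks n : setpart n :=
  exist _ [set [set i]%SET | i : 'I_n]%SET (singleton_blocks_subproof n).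

(* Removing the empty set only matters when n = 0, see val_one_block. *)
Lemma one_block_subproof n :
  finset.partition ([set [set: 'I_n]] :\ finset.set0)%SET [set: 'I_n]%SET.
Proof.
apply/and3P; split; last by rewrite !inE eqxx.
- rewrite finset.eqEsubset finset.subsetT /=; apply/fintype.subsetP => i _.
  apply/bigcupP; exists [set: 'I_n]%SET; rewrite ?inE // eqxx andbT.
  by apply/set0Pn; exists i; rewrite inE.
- apply/finset.trivIsetP => A B; rewrite !inE => /andP[_ /eqP ->] /andP[_ /eqP ->].
  by rewrite eqxx.
Qed.

Definition one_block n : setpart n :=
  exist _ ([set [set: 'I_n]] :\ finset.set0)%SET (one_block_subproof n).

Lemma val_one_block n : (0 < n)%N -> val (one_block n) = [set [set: 'I_n]]%SET.
Proof.
case: n => // n _; apply/setP => A; rewrite !inE andbC.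
by case: eqP => //= ->; apply/set0Pn; exists ord0; rewrite inE.
Qed.

Definition lower_set n (T : {set setpart n}) : Prop :=
  [/\ singleton_blocks n \in T,
      one_block n \in T &
      forall w z : setpart n,
        w \in T -> w != one_block n -> (z <= w)%O -> z \in T].

Section PartitionFunctions.
Variables (R : pzRingType) (n : nat).
Implicit Types (x t : 'rV[R]_n) (pi : setpart n).

Definition restrict0 (F : {set 'I_n}) x : 'rV[R]_n :=
  \row_i (if i \in F then x ord0 i else 0).

Definition sum_part (V : nmodType) (G : 'rV[R]_n -> V) pi x : V :=
  \sum_(F in val pi) G (restrict0 F x).

Definition prod_part (A : comPzRingType) (f : 'rV[R]_n -> A) pi x : A :=
  \prod_(F in val pi) f (restrict0 F x).

Definition lower_transform (A : comPzRingType) (T : {set setpart n})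
    (f : 'rV[R]_n -> A) t : A :=
  \sum_(pi in T) (mobius T pi (one_block n))%:~R * prod_part f pi t.

End PartitionFunctions.

(* The inequality is that of R[i]: the sum is real and nonpositive. *)
Definition cond_neg_def (R : realType) (n : nat) (G : 'rV[R]_n -> R[i]) : Prop :=
  (forall x, G (- x) = (G x)^*) /\
  (forall (m : nat) (x : 'I_m -> 'rV[R]_n) (c : 'I_m -> R[i]),
     injective x -> \sum_i c i = 0 ->
     \sum_i \sum_j c i * (c j)^* * G (x i - x j) <= 0).

(* The filter of "min_i |x_i| -> +oo": for 0 < n, r < min_i |x_i| iff
   r < |x_i| for all i. *)
Definition min_abs_pinfty (R : realType) (n : nat) : set_system 'rV[R]_n :=
  filter_from [set: R]%classic
    (fun r => [set x : 'rV[R]_n | forall i, r < `|x ord0 i|]%classic).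
Arguments min_abs_pinfty R n : clear implicits.

(* Main.v *)
Require Import Defs.
From mathcomp Require Import all_boot all_order all_algebra.
From mathcomp Require Import all_classical all_reals all_analysis.
Import Order.TTheory GRing.Theory Num.Theory.
Import numFieldNormedType.Exports.
Local Open Scope ring_scope.
Local Open Scope complex_scope.
Local Open Scope classical_set_scope.

(** Suppose that [T[e^{-G}]] vanishes identically. Each summand is
[mu(pi, 1) e^{-G_pi}], the term of the one-block partition being [e^{-G}] with
coefficient [mu(1, 1) = 1]. Multiplying the identity by [e^G] leaves
[1 + sum_(pi <> 1) mu(pi, 1) e^{G - G_pi} = 0]. As all the coordinates go to
infinity every exponent tends to [-oo], so the left-hand side tends to [1];
since there do exist points with all coordinates arbitrarily large, this
contradicts its being constantly [0]. The argument is carried out over the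
reals ([lower_transform_real]), the limit being [cvg_expR_mul_lower_transform]. *)

Section OneBlock.
Variables (R : pzRingType) (n : nat).

Lemma restrict0_setT (x : 'rV[R]_n) : restrict0 [set: 'I_n]%SET x = x.
Proof. by apply/rowP => i; rewrite mxE inE. Qed.

Lemma prod_part_one_block (A : comPzRingType) (f : 'rV[R]_n -> A) x :
  (0 < n)%N -> prod_part f (one_block n) x = f x.
Proof.
by move=> n_gt0; rewrite /prod_part val_one_block // big_set1 restrict0_setT.
Qed.

End OneBlock.

Lemma mobius_diag d (P : finPOrderType d) (T : {set P}) (x : P) :
  x \in T -> mobius T x x = 1.
Proof. by move=> xT; rewrite mobiusE // eqxx. Qed.

Lemma prod_part_expRN (R : realType) n (G : 'rV[R]_n -> R) pi x :
  prod_part (fun y => expR (- G y)) pi x = expR (- sum_part G pi x).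
Proof. by rewrite /prod_part /sum_part -sumrN expR_sum. Qed.

Lemma lower_transform_real (R : realType) n (T : {set setpart n})
    (f : 'rV[R]_n -> R) t :
  lower_transform T (fun x => (f x)%:C) t = (lower_transform T f t)%:C.
Proof.
rewrite /lower_transform raddf_sum; apply: eq_bigr => pi _ /=.
by rewrite rmorphM rmorph_int rmorph_prod.
Qed.

(** Properness is what makes limits along this filter unique: a constant vector
has all its coordinates as large as desired. *)
Lemma min_abs_pinfty_proper (R : realType) n :
  ProperFilter (min_abs_pinfty R n).
Proof.
apply: filter_from_proper => [|r _]; last first.
  exists (const_mx (`|r| + 1)) => i; rewrite mxE ger0_norm ?addr_ge0 //.
  by apply: le_lt_trans (ler_norm r) _; rewrite ltrDl.
apply: filter_fromT_filter; first by exists 0.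
move=> r s; exists (Num.max r s) => x /= rsx.
by split=> i /=; apply: le_lt_trans (rsx i); rewrite le_max lexx ?orbT.
Qed.

Lemma cvg_expRNy (R : realType) (T : Type) (F : set_system T) (g : T -> R) :
  Filter F -> g x @[x --> F] --> -oo -> expR (g x) @[x --> F] --> 0.
Proof.
move=> FF gNy; apply: cvg_comp gNy _; apply/cvgNy_compNP; exact: cvgr_expR.
Qed.

(** Multiplying by [expR (G x)] normalizes the dominant term, that of the
one-block partition, to the constant 1, and makes the others vanish in the
limit. *)
Lemma cvg_expR_mul_lower_transform (R : realType) n (G : 'rV[R]_n -> R)
    (T : {set setpart n}) (F : set_system 'rV[R]_n) :
  (0 < n)%N -> Filter F -> one_block n \in T ->
  (forall pi : setpart n, pi \in T -> pi != one_block n ->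
     G x - sum_part G pi x @[x --> F] --> -oo) ->
  expR (G x) * lower_transform T (fun y => expR (- G y)) x @[x --> F] --> (1 : R).
Proof.
move=> n_gt0 FF oneT limG.
have prodE x : expR (G x) * lower_transform T (fun y => expR (- G y)) x =
    1 + \sum_(pi in T | pi != one_block n)
      (mobius T pi (one_block n))%:~R * expR (G x - sum_part G pi x).
  rewrite /lower_transform (bigD1 _ oneT) /= mulrDr mobius_diag //.
  rewrite prod_part_one_block // mul1r -expRD subrr expR0 mulr_sumr.
  by congr (1 + _); apply: eq_bigr => pi _; rewrite prod_part_expRN expRD mulrCA.
have limE : 1 + \sum_(pi in T | pi != one_block n)
    (mobius T pi (one_block n))%:~R * 0 = 1 :> R.
  by rewrite big1 ?addr0 // => pi _; rewrite mulr0.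
rewrite -limE (funext prodE).
apply: cvgD; first exact: cvg_cst.
apply: cvg_big => [|pi /andP[piT pi1]]; first exact: add_continuous.
by apply: cvgMl_tmp; apply: cvg_expRNy; apply: limG.
Qed.

Theorem lemma7p2 (R : realType) (n : nat) (n_gt0 : (0 < n)%N)
    (G : 'rV[R]_n -> R) (T : {set setpart n})
    (G_cont : continuous G)
    (G_cnd : cond_neg_def (fun x => (G x)%:C))
    (G0 : G 0 = 0)
    (T_lower : lower_set T)
    (G_lim : forall pi : setpart n, pi \in T -> pi != one_block n ->
       (fun x => G x - sum_part G pi x) @ min_abs_pinfty R n --> -oo) :
  ~ (forall t : 'rV[R]_n,
       lower_transform T (fun x => (expR (- G x))%:C) t = 0).
Proof.
move=> T0; have [_ oneT _] := T_lower.
have PF := min_abs_pinfty_proper R n.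
have FF : Filter (min_abs_pinfty R n) by exact: filter_filter.
have := cvg_expR_mul_lower_transform R n G T _ n_gt0 FF oneT G_lim.
have T0R : (fun t => expR (G t) * lower_transform T (fun x => expR (- G x)) t)
    = fun=> 0.
  apply: funext => t; have := T0 t; rewrite lower_transform_real => /complexI->.
  by rewrite mulr0.
rewrite T0R => lim1; have /eqP : (1 : R) = 0.
  by apply: norm_cvg_unique lim1 _; apply: cvg_cst.
by rewrite oner_eq0.
Qed.
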